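(* For every $\varepsilon>0$ there exists $k_0$ such that for all integers $k\ge k_0$, $$r(k)\le (1+\varepsilon)\,k^{k-1}.$$ That is, $r(k)\le (1+o(1))k^{k-1}$ as $k\to\infty$.
   Context: A $k$-uniform family (hypergraph) on a finite set $X$ is a family $\mathcal{F}\subseteq\binom{X}{k}$ of $k$-element subsets of $X$, called edges. $\mathcal{F}$ is intersecting if $e_1\cap e_2\neq\emptyset$ for all $e_1,e_2\in\mathcal{F}$. A set $C\subseteq X$ is a cover of $\mathcal{F}$ if $f\cap C\neq\emptyset$ for every $f\in\mathcal{F}$. The covering number is $\tau(\mathcal{F})=\min\{|C|: C \text{ is a cover of } \mathcal{F}\}$. Define $r(k)$ as the maximum of $|\mathcal{F}|$ over all $k$-uniform intersecting families $\mathcal{F}$ with $\tau(\mathcal{F})=k$, where the finite ground set $X$ is arbitrary (no restriction on $|X|$). *)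

(* Defs.v *)
From mathcomp Require Import all_boot.
From Stdlib Require Import Reals.
Set Implicit Arguments. Unset Strict Implicit. Unset Printing Implicit Defensive.

Definition kuniform (T : finType) (k : nat) (F : {set {set T}}) : Prop :=
  forall e, e \in F -> #|e| = k.

Definition intersecting (T : finType) (F : {set {set T}}) : Prop :=
  forall e1 e2, e1 \in F -> e2 \in F -> e1 :&: e2 != set0.

Definition is_cover (T : finType) (F : {set {set T}}) (C : {set T}) : bool :=
  [forall f in F, f :&: C != set0].

(* covering number: minimum size of a cover (junk value #|T|.+1 if no cover
   exists, which only happens when F contains the empty edge). *)
Definition tau (T : finType) (F : {set {set T}}) : nat :=
  \big[minn/#|T|.+1]_(C : {set T} | is_cover F C) #|C|.

(* Main.v *)
(* Grow a path x_1, x_2, ... of points: at each step choose an edge e_i of F disjoint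
   from the points so far (possible as long as there are fewer than k of them) and let
   x_i range over e_i.  There are k^k paths of length k, and every f in F is the set of
   points of some of them; giving a path the weight prod_i 1/|f & e_i| makes the paths
   leading to f carry total weight one.  So |F| is at most the sum over all paths p of
   prod_i 1/|p & e_i|.

   To make these weights small, cut an initial part of the path into three stages of
   length 2h, with h of order k, and always choose e_i maximising |e_i & U|, where U is
   the union of the earlier edges of the stage.  A point x_i falling in U lies in some
   earlier e_j, so a stage with Z such repetitions contributes at least 1 + Z to
   prod_i |p & e_i|.  The overlaps |e_i & U| always add up to at least h s over a stage,
   with s of order sqrt k: otherwise the edges avoiding the path meet U in so few points
   that about sqrt k of them can be found with pairwise disjoint traces on U; each of the
   order k earlier edges of the stage meets all these traces, so their overlaps are
   large.  Hence a random path has many repetitions in each stage: with M about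
   (2k)^(1/3), the event Z <= M is exponentially unlikely, and the weight is at most
   M^-3 <= 1/(2k) otherwise. *)
Require Import Defs.
From mathcomp Require Import all_boot all_order all_algebra.
From mathcomp Require Import zify lra.

Set Implicit Arguments. Unset Strict Implicit. Unset Printing Implicit Defensive.
Import Order.TTheory GRing.Theory Num.Theory.

(** * Elementary estimates and the choice of scales *)

Section Numbers.
Local Open Scope ring_scope.
Variable R : realFieldType.

Lemma bernoulli_sub (x : R) (u : nat) : 0 <= x -> x <= 1 -> 1 - u%:R * x <= (1 - x) ^+ u.
Proof.
move=> x0 x1; elim: u => [|u IH]; first by rewrite mul0r subr0 expr0.
rewrite exprS; apply: le_trans (ler_wpM2l _ IH); last by rewrite subr_ge0.
by rewrite -natr1; have := mulr_ge0 (ler0n R u) (mulr_ge0 x0 x0); nra.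
Qed.

Lemma bernoulli_add (x : R) (u : nat) : 0 <= x -> 1 + u%:R * x <= (1 + x) ^+ u.
Proof.
move=> x0; elim: u => [|u IH]; first by rewrite mul0r addr0 expr0.
rewrite exprS; apply: le_trans (ler_wpM2l _ IH); last by rewrite addr_ge0.
by rewrite -natr1; have := mulr_ge0 (ler0n R u) (mulr_ge0 x0 x0); nra.
Qed.

(** With x = 1/m, Bernoulli gives (1 + x)^m >= 2, while (1 - x)^m (1 + x)^m = (1 - x^2)^m <= 1. *)
Lemma exp_sub_inv_le_half (m : nat) : (0 < m)%N -> (1 - m%:R^-1) ^+ m <= 2^-1 :> R.
Proof.
move=> m0; set x : R := m%:R^-1.
have x0 : 0 <= x by rewrite invr_ge0 ler0n.
have x1 : x <= 1 by rewrite invf_le1 ?ltr0n ?ler1n.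
have two : 2 <= (1 + x) ^+ m.
  by apply: le_trans (bernoulli_add m x0); rewrite mulfV // pnatr_eq0 -lt0n.
rewrite -[leRHS]mul1r ler_pdivlMr ?ltr0n //.
apply: le_trans (ler_wpM2l _ two) _; first by rewrite exprn_ge0 // subr_ge0.
rewrite -exprMn exprn_ile1 //; first by rewrite mulr_ge0 ?subr_ge0 ?addr_ge0.
by have := mulr_ge0 x0 x0; nra.
Qed.

End Numbers.

Lemma cube_le_exp2 (M : nat) : (20 <= M)%N -> (3 * M ^ 3 <= 2 ^ M)%N.
Proof.
move=> M20; rewrite -(subnKC M20); elim: (M - 20)%N => [|i IH].
  by rewrite addn0 (expnD 2 10 10); lia.
rewrite addnS expnS; apply: leq_trans (_ : 2 * (3 * (20 + i) ^ 3) <= _)%N; last first.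
  by rewrite leq_mul2l.
by rewrite !expnS expn0; nia.
Qed.

(** Three stages of length [2 * h] use at most [6 * h] steps, and [7 * h <= k] leaves [h] points of
    room for a multicover. The constant 2048 comes from 2 s^2 with s = 32 M. *)
Lemma exists_scales : exists k0 : nat, forall k, (k0 <= k)%N ->
  exists h M : nat, [/\ (0 < M)%N, (7 * h <= k)%N, (k <= 8 * h)%N, (2048 * (M * M) <= h)%N
    & (2 * k <= M ^ 3)%N /\ (6 * k <= 2 ^ M)%N].
Proof.
(* For M = p + 1 minimal and p >= c, c p^2 <= p^3 < 2k <= 16h gives h > 2500 p^2, enough for 2048 (p
   + 1)^2. *)
have [c cE] : exists c : nat, c = (200 * 200)%N by exists (200 * 200)%N.
exists (c * (c * c))%N => k ck.
have exM : exists M, (2 * k <= M * (M * M))%N by exists (2 * k)%N; nia.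
have [M hM minM] := ex_minnP exM.
have cM : (c < M)%N.
  rewrite ltnNge; apply/negP => Mc.
  have : (M * (M * M) <= c * (c * c))%N by rewrite !leq_mul.
  by nia.
case: M hM minM cM => // p hM minM cM.
have hp : (p * (p * p) < 2 * k)%N.
  by rewrite ltnNge; apply/negP => /minM; rewrite ltnn.
have cp : (c <= p)%N by lia.
exists ((k + 7) %/ 8)%N, p.+1.
have kbig : (49 <= k)%N.
  have : (c <= k)%N by apply: leq_trans ck; rewrite leq_pmulr // muln_gt0; lia.
  by lia.
have kh : (k <= 8 * ((k + 7) %/ 8))%N by lia.
have cube : (p.+1 ^ 3 = p.+1 * (p.+1 * p.+1))%N by rewrite !expnS expn0 muln1.
split=> //; first by lia.
  move: ((k + 7) %/ 8)%N kh => h kh.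
  have : (200 * 200 * (p * p) <= p * (p * p))%N by rewrite leq_mul // -cE.
  by nia.
split; first by rewrite cube.
apply: leq_trans (cube_le_exp2 (M := p.+1) _); last by lia.
by rewrite cube; lia.
Qed.

Lemma bigminn_le (I : eqType) (r : seq I) (P : pred I) (f : I -> nat) x i :
  i \in r -> P i -> (\big[minn/x]_(j <- r | P j) f j <= f i)%N.
Proof.
move=> ir Pi; elim: r ir => //= j r IH; rewrite big_cons inE => /orP[/eqP <-|/IH le].
  by rewrite Pi geq_minl.
by case: ifP => // _; apply: leq_trans (geq_minr _ _) le.
Qed.

Lemma tau_avoid (T : finType) (F : {set {set T}}) (C : {set T}) :
  (#|C| < tau F)%N -> exists2 g, g \in F & [disjoint g & C].
Proof.
move=> ltC; have : ~~ is_cover F C.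
  apply: contraL ltC => covC; rewrite -leqNgt /tau.
  by apply: bigminn_le; rewrite ?mem_index_enum.
case/forall_inPn => g gF; rewrite negbK setI_eq0 => dis; by exists g.
Qed.

(** * Sums over paths and the weights of steps *)

Section PathSums.
Local Open Scope ring_scope.
Variables (R : realFieldType) (T : finType) (e : seq T -> {set T}).

(* Paths are listed with the most recent point first. *)
Fixpoint path_to (s : seq T) : bool :=
  if s is x :: s' then (x \in e s') && path_to s' else true.

Fixpoint path_sum (m : nat) (g : seq T -> R) (s : seq T) : R :=
  if m is m'.+1 then \sum_(x in e s) path_sum m' g (x :: s) else g s.

Fixpoint step_sum (h : T -> seq T -> nat) (s : seq T) : nat :=
  if s is x :: s' then (h x s' + step_sum h s')%N else 0%N.

Fixpoint step_prod (h : seq T -> nat) (s : seq T) : nat :=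
  if s is _ :: s' then (h s' * step_prod h s')%N else 1%N.

Lemma path_sum_le m g h s :
  path_to s ->
  (forall s', path_to s' -> size s' = (m + size s)%N -> g s' <= h s') ->
  path_sum m g s <= path_sum m h s.
Proof.
elim: m s => [|m IH] s ps le_gh /=; first exact: le_gh.
apply: ler_sum => x xe; apply: IH => /= [|s' ps' sz]; first by rewrite xe.
by apply: le_gh => //; rewrite sz /=; lia.
Qed.

Lemma path_sumD m g h s :
  path_sum m (fun s => g s + h s) s = path_sum m g s + path_sum m h s.
Proof.
elim: m s => [|m IH] s //=.
by rewrite -big_split /=; apply: eq_bigr => x _; apply: IH.
Qed.

Lemma path_sumZ m a g s :
  path_sum m (fun s => a * g s) s = a * path_sum m g s.
Proof.
elim: m s => [|m IH] s //=.
by rewrite mulr_sumr; apply: eq_bigr => x _; apply: IH.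
Qed.

Lemma path_sum_sum m (I : finType) (P : {pred I}) (g : I -> seq T -> R) s :
  path_sum m (fun s => \sum_(i in P) g i s) s = \sum_(i in P) path_sum m (g i) s.
Proof.
elim: m s => [|m IH] s //=.
by rewrite exchange_big /=; apply: eq_bigr => x _; apply: IH.
Qed.

Lemma path_sum_const (k m : nat) a s :
  (forall s', path_to s' -> (size s' < m + size s)%N -> #|e s'| = k) ->
  path_to s -> path_sum m (fun=> a) s = (k ^ m)%:R * a.
Proof.
elim: m s => [|m IH] s szE ps /=; first by rewrite expn0 mul1r.
rewrite (eq_bigr (fun=> (k ^ m)%:R * a)) => [|x xe]; last first.
  by apply: IH => [s' ps' lt|]; rewrite /= ?xe //; apply: szE => //=; move: lt => /=; lia.
rewrite sumr_const szE //; last by lia.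
by rewrite -[LHS]mulr_natl mulrA -natrM expnS.
Qed.


(** [P] selects steps by their index; the value 1 makes the other steps neutral in [step_prod]. *)
Definition meets (P : pred nat) (S : {set T}) (s : seq T) : nat :=
  if P (size s) then #|S :&: e s| else 1%N.

Lemma meets_gt0 P (S : {set T}) s x : x \in e s -> x \in S -> (0 < meets P S s)%N.
Proof.
move=> xe xS; rewrite /meets; case: ifP => // _.
by apply/card_gt0P; exists x; rewrite inE xS.
Qed.

Lemma step_prod_meets_gt0 P (S : {set T}) s :
  path_to s -> {subset s <= S} -> (0 < step_prod (meets P S) s)%N.
Proof.
elim: s => //= x s IH /andP[xe ps] sS; rewrite muln_gt0.
rewrite (@meets_gt0 _ _ _ x) ?sS ?mem_head //=.
by apply: IH => // y ys; rewrite sS // inE ys orbT.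
Qed.

Lemma step_prod_meetsS P (S S' : {set T}) s :
  S \subset S' -> (step_prod (meets P S) s <= step_prod (meets P S') s)%N.
Proof.
move=> SS'; elim: s => //= x s IH; apply: leq_mul => //.
by rewrite /meets; case: ifP => // _; apply: subset_leq_card; exact: setSI.
Qed.

(* The paths inside [f] that meet all [e s] carry total weight one: at [s], the
   weight is split evenly among the elements of [f :&: e s]. *)
Lemma path_sum_meets m (f : {set T}) s :
  (forall s', (size s' < m + size s)%N -> f :&: e s' != set0) ->
  path_sum m (fun s => if all (mem f) s then (step_prod (meets xpredT f) s)%:R^-1 else 0 : R) s
  = if all (mem f) s then (step_prod (meets xpredT f) s)%:R^-1 else 0.
Proof.
elim: m s => [|m IH] s meet //=.
rewrite (eq_bigr (fun x => if all (mem f) (x :: s)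
    then (step_prod (meets xpredT f) (x :: s))%:R^-1 else 0 : R)); last first.
  by move=> x _; apply: IH => s' /= lt; apply: meet; move: lt => /=; lia.
rewrite /=; case: ifP => fs; last by rewrite big1 // => x _; rewrite andbF.
rewrite -big_mkcondr /=.
rewrite (eq_bigl (mem (f :&: e s))) => [|x]; last by rewrite !inE andbT andbC.
rewrite sumr_const /meets /= natrM invfM -[LHS]mulr_natl mulrA mulfV ?mul1r //.
by rewrite pnatr_eq0 cards_eq0 meet //; lia.
Qed.

End PathSums.

(** * The greedy choice of edges *)

Section Strategy.
Local Open Scope nat_scope.
Variables (R : realFieldType) (T : finType) (F : {set {set T}}) (k n : nat).
Hypothesis uniF : kuniform k F.
Hypothesis intF : intersecting F.
Hypothesis avoidF : forall C : {set T}, #|C| < k ->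
  exists2 g, g \in F & [disjoint g & C].

(** The default [set0] arises only when every edge meets [s], which [avoidF] excludes as long as
    [size s < k]. *)
Definition best (U : {set T}) (s : seq T) : {set T} :=
  odflt set0 [pick g in F | [disjoint g & s] &&
    [forall g' in F, [disjoint g' & s] ==> (#|g' :&: U| <= #|g :&: U|)]].

(* The edges chosen since the last multiple of [n] steps. *)
Fixpoint stage_edges (s : seq T) : seq {set T} :=
  if s is _ :: s' then
    if n %| (size s').+1 then [::]
    else best (\bigcup_(g <- stage_edges s') g) s' :: stage_edges s'
  else [::].

Definition stage_union (s : seq T) : {set T} := \bigcup_(g <- stage_edges s) g.

Definition next_edge (s : seq T) : {set T} := best (stage_union s) s.

Definition overlap (s : seq T) : nat := #|next_edge s :&: stage_union s|.

Lemma next_edgeP s : size s < k ->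
  [/\ next_edge s \in F, [disjoint next_edge s & s]
    & forall g, g \in F -> [disjoint g & s] -> #|g :&: stage_union s| <= overlap s].
Proof.
move=> szs; rewrite /overlap /next_edge /best.
case: pickP => [g /and3P[gF gs /forall_inP gmax]|noG] /=.
  by split=> // g' g'F g's; have /implyP := gmax _ g'F; apply.
have [|g0 g0F g0s] := avoidF (C := [set:: s]).
  by apply: leq_ltn_trans szs; rewrite cardsE card_size.
have eqs g : [disjoint g & [set:: s]] = [disjoint g & s].
  by apply: eq_disjoint_r => x; rewrite !inE.
rewrite eqs in g0s.
pose P g := (g \in F) && [disjoint g & s].
have Pg0 : P g0 by rewrite /P g0F.
case: (@arg_maxnP _ g0 P (fun g => #|g :&: stage_union s|) Pg0) => g /andP[gF gs] gmax.
move: (noG g); rewrite /= gF gs /= => /negP[].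
by apply/forall_inP => g' g'F; apply/implyP => g's; apply: gmax; rewrite /P g'F.
Qed.

Lemma stage_union_cons x s :
  stage_union (x :: s) =
    if n %| (size s).+1 then set0 else next_edge s :|: stage_union s.
Proof.
by rewrite /stage_union /=; case: ifP => _; rewrite ?big_nil // big_cons.
Qed.

Lemma path_uniq s : path_to next_edge s -> size s <= k -> uniq s.
Proof.
elim: s => //= x s IH /andP[xe ps] szs; rewrite IH ?(ltnW szs) // andbT.
have [_ dis _] := next_edgeP szs.
by rewrite (disjointFr dis xe).
Qed.

(** * Repetitions force large products of intersections *)

Definition in_stage (l i : nat) : bool := i %/ n == l.

Definition repeats (l : nat) : seq T -> nat :=
  step_sum (fun x s => in_stage l (size s) && (x \in stage_union s)).

Definition stage_overlap (l : nat) : seq T -> nat :=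
  step_sum (fun _ s => in_stage l (size s) * overlap s).

Lemma divnS_ndvd i : ~~ (n %| i.+1) -> i.+1 %/ n = i %/ n.
Proof.
case: (posnP n) => [->|n0] ndv; first by rewrite !divn0.
by rewrite divnS // (negbTE ndv).
Qed.

(** At an earlier step of the stage whose edge contains [x], the factor strictly grows when [x]
    joins [S]; all other factors are positive and do not decrease. *)
Lemma meets_ltU1 l x (S : {set T}) s :
  path_to next_edge s -> {subset s <= S} -> in_stage l (size s) ->
  x \in stage_union s -> x \notin S ->
  step_prod (meets next_edge (in_stage l) S) s
    < step_prod (meets next_edge (in_stage l) (x |: S)) s.
Proof.
elim: s => [|y s IH] /=; first by rewrite /stage_union big_nil inE.
case/andP=> ye ps sS inl; rewrite stage_union_cons.
case: ifP => [|/negbT ndv]; first by rewrite inE.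
rewrite /in_stage divnS_ndvd // -/(in_stage l _) in inl.
have yS : y \in S by rewrite sS ?mem_head.
have sS' : {subset s <= S} by move=> z zs; rewrite sS // inE zs orbT.
have m0 := @meets_gt0 _ next_edge (in_stage l) S s y ye yS.
have p0 := @step_prod_meets_gt0 _ next_edge (in_stage l) S s ps sS'.
have pS := @step_prod_meetsS _ next_edge (in_stage l) _ _ s (subsetU1 x S).
move=> xU xS; case: (boolP (x \in next_edge s)) xU => [xe _|xe].
  suff lt : meets next_edge (in_stage l) S s < meets next_edge (in_stage l) (x |: S) s.
    by nia.
  rewrite /meets inl; apply: proper_card; rewrite properE setSI ?subsetU1 //=.
  by apply/subsetPn; exists x; rewrite !inE ?eqxx ?xe // (negbTE xS).
rewrite inE (negbTE xe) /= => xU.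
have := IH ps sS' inl xU xS.
have : meets next_edge (in_stage l) S s <= meets next_edge (in_stage l) (x |: S) s.
  by rewrite /meets; case: ifP => // _; apply: subset_leq_card; rewrite setSI ?subsetU1.
by nia.
Qed.

(* A repetition [x \in stage_union s] increments the size of the intersection with
   some earlier edge of the stage, hence increases the product by at least one. *)
Lemma repeats_lt_meets l s : path_to next_edge s -> uniq s ->
  repeats l s < step_prod (meets next_edge (in_stage l) [set:: s]) s.
Proof.
elim: s => //= x s IH /andP[xe ps] /andP[xs us].
have {IH} lt := IH ps us.
have m0 : 0 < meets next_edge (in_stage l) [set:: x :: s] s.
  by apply: (@meets_gt0 _ _ _ _ _ x); rewrite // inE mem_head.
have eqS : [set:: x :: s] = x |: [set:: s] by apply/setP=> y; rewrite !inE.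
rewrite eqS in m0 *.
have pS := @step_prod_meetsS _ next_edge (in_stage l) _ _ s (subsetU1 x [set:: s]).
rewrite /repeats /=; case: (boolP (_ && _)) => [/andP[inl xU]|_]; last first.
  by rewrite add0n; apply: leq_trans lt _; apply: leq_trans pS (leq_pmull _ m0).
apply: leq_ltn_trans lt _; apply: leq_trans _ (leq_pmull _ m0).
by apply: meets_ltU1 => // [y|]; rewrite inE.
Qed.

(** A step lies in at most one stage, and a step in none of the three has a factor at least one,
    since its own point lies in [S]. *)
Lemma step_prod_stages (S : {set T}) s : path_to next_edge s -> {subset s <= S} ->
  step_prod (meets next_edge (in_stage 0) S) s *
  step_prod (meets next_edge (in_stage 1) S) s *
  step_prod (meets next_edge (in_stage 2) S) s
    <= step_prod (meets next_edge xpredT S) s.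
Proof.
elim: s => //= x s IH /andP[xe ps] sS.
have m0 : 0 < #|S :&: next_edge s|.
  by apply: (@meets_gt0 _ _ xpredT _ _ x) => //; rewrite sS ?mem_head.
have {}IH := IH ps (fun y ys => sS y (mem_behead (s := x :: s) ys)).
rewrite [X in X * _ <= _]mulnACA [leqLHS]mulnACA.
apply: leq_mul IH; rewrite /meets /in_stage.
by case: (size s %/ n) => [|[|[|i]]] /=; rewrite ?muln1 ?mul1n.
Qed.

(** * Lower bound for the overlaps of a stage *)

Lemma stage_edges_sub s g : size s <= k -> g \in stage_edges s -> g \in F.
Proof.
elim: s => //= x s IH szs; case: ifP => // _; rewrite inE => /orP[/eqP->|].
  by have [] := next_edgeP szs.
by apply: IH; apply: ltnW.
Qed.

Lemma size_stage_edges s : 0 < n -> size (stage_edges s) = size s %% n.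
Proof.
move=> n0; elim: s => [|x s IH] /=; first by rewrite mod0n.
by rewrite modnS; case: ifP => //= _; rewrite IH.
Qed.

(** Incidences with [C] are counted edge by edge: a point already in the union is charged to the
    overlap, and a new one enlarges the trace of the union on [C]. *)
Lemma sum_stage_edges_le (C : {set T}) s :
  \sum_(g <- stage_edges s) #|g :&: C|
    <= stage_overlap (size s %/ n) s + #|C :&: stage_union s|.
Proof.
elim: s => [|x s IH] /=; first by rewrite big_nil.
rewrite stage_union_cons; case: ifP => [|/negbT ndv]; first by rewrite big_nil.
rewrite big_cons -/(next_edge s) divnS_ndvd // /stage_overlap /= {1}/in_stage eqxx mul1n.
rewrite -/(stage_overlap _ s).
set e := next_edge s; set U := stage_union s.
have -> : #|C :&: (e :|: U)| = #|C :&: U| + #|(e :&: C) :\: U|.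
  rewrite -(cardsID U (C :&: _)); congr addn; apply: eq_card => z; rewrite !inE;
    by case: (z \in U); case: (z \in C); case: (z \in e).
rewrite -(cardsID U (e :&: C)).
have : #|e :&: C :&: U| <= overlap s by rewrite subset_leq_card // setIAC subsetIl.
by rewrite -/U in IH; lia.
Qed.

(* When every available edge meets the union in at most [s0] elements, removing these
   elements one edge at a time produces [q] disjoint sets, each of which meets all the
   edges of the stage. *)
Lemma exists_multicover (s0 q : nat) s : 0 < s0 -> size s + q * s0 <= k ->
  (forall g, g \in F -> [disjoint g & s] -> #|g :&: stage_union s| <= s0) ->
  exists2 C : {set T}, #|C| <= q * s0 & forall g, g \in stage_edges s -> q <= #|g :&: C|.
Proof.
move=> s00; elim: q => [|q IH] szs small; first by exists set0; rewrite ?cards0.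
have [||C szC hitC] := IH => //.
  by apply: leq_trans szs; rewrite leq_add2l mulSn leq_addl.
have [|g gF disg] := avoidF (C := [set:: s] :|: C).
  apply: leq_ltn_trans (leq_card_setU _ _) _.
  have : #|[set:: s]| <= size s by rewrite cardsE card_size.
  by move: szs; rewrite mulSn; lia.
have gs : [disjoint g & s].
  by apply: disjointWr disg; apply/subsetP => z zs; rewrite !inE zs.
have gC : [disjoint g & C] by apply: disjointWr disg; apply: subsetUr.
exists (g :&: stage_union s :|: C) => [|g' g's].
  by apply: leq_trans (leq_card_setU _ _) _; rewrite mulSn leq_add // small.
have g'F : g' \in F.
  by apply: stage_edges_sub g's; apply: leq_trans szs; apply: leq_addr.
have g'U : g' \subset stage_union s.
  apply/subsetP => z zg'; rewrite /stage_union.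
  by rewrite (big_rem g') //= inE zg'.
apply: leq_ltn_trans (hitC _ g's) _; apply: proper_card.
have /set0Pn[z /setIP[zg zg']] := intF gF g'F.
rewrite properE setIS ?subsetUr //=; apply/subsetPn; exists z.
  by rewrite !inE zg' zg (subsetP g'U).
by rewrite inE zg' (disjointFr gC zg).
Qed.

(* If the overlap drops below [s0] at some step of the second half, the multicover given
   by [exists_multicover] shows that the overlaps of the stage already add up to
   [h * s0]. *)
Lemma stage_overlap_second_half (h s0 l j : nat) s :
  n = h + h -> 0 < s0 -> s0 + s0 <= h ->
  l.+1 * n + (s0 + s0) * s0 <= k ->
  j <= h -> size s = l * n + h + j -> j * s0 <= stage_overlap l s.
Proof.
move=> nE s00 s0h nk; elim: j s => [//|j IH] [|x s] jh; first by rewrite addnS.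
rewrite addnS => -[szs]; rewrite /stage_overlap /= -/(stage_overlap l s).
have n0 : 0 < n by lia.
have szsE : size s = l * n + (h + j) by rewrite szs addnA.
have lt_n : h + j < n by lia.
have inl : size s %/ n = l by rewrite szsE divnMDl // divn_small // addn0.
rewrite /in_stage inl eqxx mul1n.
case: (leqP s0 (overlap s)) => [le|lt].
  by rewrite mulSn leq_add // IH // ltnW.
(* The multicover is taken with q = 2 s0. The h + j edges so far have at least 2 s0 (h + j)
   incidences with it, at most 2 s0^2 of them new, so the overlaps reach 2 s0 (h + j - s0) >= (j +
   1) s0. *)
have szk : size s + (s0 + s0) * s0 <= k.
  by apply: leq_trans nk; rewrite leq_add2r szsE mulSn; lia.
have [|C szC hitC] := exists_multicover s00 szk.
  move=> g gF gs; have [|_ _ ov] := @next_edgeP s; last exact: leq_trans (ov g gF gs) (ltnW lt).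
  by rewrite szsE; move: nk; rewrite mulSn; lia.
have := sum_stage_edges_le C s; rewrite inl => le.
have ge : (h + j) * (s0 + s0) <= \sum_(g <- stage_edges s) #|g :&: C|.
  have -> : (h + j) * (s0 + s0) = \sum_(g <- stage_edges s) (s0 + s0).
    rewrite big_const_seq count_predT iter_addn_0 size_stage_edges // szsE.
    by rewrite modnMDl modn_small // mulnC.
  by rewrite !big_seq leq_sum.
have leC : #|C :&: stage_union s| <= (s0 + s0) * s0.
  by apply: leq_trans szC; rewrite subset_leq_card ?subsetIl.
apply: leq_trans (leq_addl _ _); nia.
Qed.

Lemma step_sum_drop (f : T -> seq T -> nat) i s :
  step_sum f (drop i s) <= step_sum f s.
Proof.
elim: s i => [|x s IH] [|i] //=.
by apply: leq_trans (IH i) (leq_addl _ _).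
Qed.

Lemma stage_overlap_ge (h s0 l : nat) s :
  n = h + h -> 0 < s0 -> s0 + s0 <= h ->
  l.+1 * n + (s0 + s0) * s0 <= k -> size s = k -> h * s0 <= stage_overlap l s.
Proof.
move=> nE s00 s0h nk szs.
(* The most recent points come first, so this drop leaves the path as it stood at the end of stage
   [l]. *)
apply: leq_trans (step_sum_drop _ (k - l.+1 * n) s).
apply: (@stage_overlap_second_half h) => //.
rewrite size_drop szs subKn; first by rewrite mulSn nE; lia.
by apply: leq_trans nk; apply: leq_addr.
Qed.

(** * Exponential moments of the number of repetitions *)

Local Open Scope ring_scope.

(** A supermartingale for the random path: with overlap u, the u repeated points of the next edge
    count 1/2 and the others 1, and the total k - u/2 is at most k beta^u. *)
Definition potential (beta : R) (l : nat) (s : seq T) : R :=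
  2^-1 ^+ repeats l s / beta ^+ stage_overlap l s.

Lemma path_sum_potential (beta : R) l m s :
  0 < beta -> (forall u : nat, (u <= k)%N -> k%:R - u%:R / 2 <= k%:R * beta ^+ u) ->
  path_to next_edge s -> (m + size s)%N = k ->
  path_sum next_edge m (potential beta l) s <= (k ^ m)%:R * potential beta l s.
Proof.
move=> b0 hb; elim: m s => [|m IH] s ps szs /=; first by rewrite expn0 mul1r.
have lt : (size s < k)%N by rewrite -szs; lia.
have [eF _ _] := next_edgeP lt.
set c := (in_stage l (size s)).
pose w x : R := if c && (x \in stage_union s) then 2^-1 else 1.
have potE x : potential beta l (x :: s) =
    potential beta l s * (w x / beta ^+ (c * overlap s)).
  rewrite /potential /repeats /stage_overlap /= -/c !exprD invfM /w.
  by case: (c && _); rewrite mulrACA mulrC.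
apply: le_trans (_ : \sum_(x in next_edge s) (k ^ m)%:R * potential beta l (x :: s) <= _).
  by apply: ler_sum => x xe; apply: IH; rewrite /= ?xe // addnS -szs.
under eq_bigr => x _ do rewrite potE mulrA.
rewrite -mulr_sumr -mulr_suml.
have sumw : \sum_(x in next_edge s) w x <= k%:R * beta ^+ (c * overlap s).
  case: (boolP c) (hb (overlap s)) => [cT|cF] hbs.
    apply: le_trans (_ : k%:R - (overlap s)%:R / 2 <= _); last first.
      by rewrite mul1n hbs // -(uniF eF) subset_leq_card ?subsetIl.
    rewrite (bigID (mem (stage_union s))) /=.
    rewrite (eq_bigr (fun=> 2^-1)) => [|x /andP[_ xU]]; last by rewrite /w cT xU.
    rewrite [X in _ + X](eq_bigr (fun=> 1)) => [|x /andP[_ xU]]; last first.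
      by rewrite /w (negbTE xU) andbF.
    rewrite !sumr_const -(uniF eF).
    rewrite -(cardsID (stage_union s) (next_edge s)) natrD -/(overlap s).
    have -> : #|[pred i in next_edge s | i \in stage_union s]| = overlap s.
      by apply: eq_card => x; rewrite !inE.
    have -> : #|[pred i in next_edge s | i \notin stage_union s]|
        = #|next_edge s :\: stage_union s|.
      by apply: eq_card => x; rewrite !inE andbC.
    by rewrite -[X in X + _]mulr_natl addrAC lerD2r [X in X - _]splitr addrK.
  rewrite mul0n expr0 mulr1 (eq_bigr (fun=> 1)) => [|x _]; last by rewrite /w (negbTE cF).
  by rewrite sumr_const (uniF eF).
have pot0 : 0 <= potential beta l s 
  by apply: divr_ge0; apply: exprn_ge0; rewrite ?invr_ge0 ?ler0n // ltW.
move: (potential beta l s) pot0 => P P0.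
rewrite expnSr natrM -!mulrA; apply: ler_wpM2l => //.
rewrite [leRHS]mulrC; apply: ler_wpM2l => //.
by rewrite ler_pdivrMr ?exprn_gt0.
Qed.

(** * From path sums to the size of the family *)

Lemma card_le_path_sum :
  #|F|%:R <= path_sum next_edge k
    (fun s => (step_prod (meets next_edge xpredT [set:: s]) s)%:R^-1 : R) [::].
Proof.
pose g (f : {set T}) s : R :=
  if all (mem f) s then (step_prod (meets next_edge xpredT f) s)%:R^-1 else 0.
have <- : path_sum next_edge k (fun s => \sum_(f in F) g f s) [::] = #|F|%:R.
  rewrite path_sum_sum (eq_bigr (fun=> 1)) ?sumr_const // => f fF.
  rewrite path_sum_meets /= ?invr1 // => s; rewrite addn0 => szs.
  by have [eF _ _] := next_edgeP szs; apply: intF.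
apply: path_sum_le => // s ps; rewrite addn0 => szs.
(* The k points of the path are distinct, so the only edge that can contain them is their own set:
   at most one term of the sum over [F] survives. *)
have szS : #|[set:: s]| = k.
  by rewrite cardsE; move/card_uniqP: (path_uniq ps (eq_leq szs)) => ->.
have gS f : f \in F -> f != [set:: s] -> g f s = 0.
  move=> fF fS; rewrite /g; case: ifP => // /allP sf; case/negP: fS.
  rewrite eq_sym eqEcard szS (uniF fF) leqnn andbT.
  by apply/subsetP => x; rewrite inE => /sf.
have X0 : 0 <= (step_prod (meets next_edge xpredT [set:: s]) s)%:R^-1 :> R.
  by rewrite invr_ge0 ler0n.
case: (boolP ([set:: s] \in F)) => [SF|SnF].
  rewrite (bigD1 [set:: s]) //= big1 ?addr0 => [|f /andP[]]; last exact: gS.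
  by rewrite /g; case: ifP.
rewrite big1 // => f fF; apply: gS => //.
by apply: contraNneq SnF => <-.
Qed.

(** If some stage has Z <= M repetitions, its term 2^(M - Z) is already at least one; otherwise each
    of the three stage products exceeds M. *)
Lemma inv_step_prod_le (M : nat) s : (0 < M)%N -> path_to next_edge s -> uniq s ->
  (step_prod (meets next_edge xpredT [set:: s]) s)%:R^-1 <=
    M%:R ^- 3 + 2 ^+ M * (2^-1 ^+ repeats 0 s + 2^-1 ^+ repeats 1 s + 2^-1 ^+ repeats 2 s) :> R.
Proof.
move=> M0 ps us.
have sS : {subset s <= [set:: s]} by move=> x xs; rewrite inE.
have D0 := repeats_lt_meets 0 ps us.
have D1 := repeats_lt_meets 1 ps us.
have D2 := repeats_lt_meets 2 ps us.
have DD := step_prod_stages ps sS.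
set X := step_prod (meets next_edge xpredT _) s in DD *.
have Xgt0 : (0 < X)%N by apply: leq_trans DD; rewrite !muln_gt0; lia.
have z0 i : 0 <= 2^-1 ^+ i :> R by rewrite exprn_ge0 // invr_ge0 ler0n.
have M30 : 0 <= M%:R ^- 3 :> R by rewrite invr_ge0 exprn_ge0.
have small Z : (Z <= M)%N -> X%:R^-1 <= 2 ^+ M * 2^-1 ^+ Z :> R.
  move=> ZM; apply: (@le_trans _ _ 1); first by rewrite invf_le1 ?ltr0n ?ler1n.
  rewrite -(subnK ZM) exprD -mulrA -exprMn mulfV ?pnatr_eq0 // expr1n mulr1.
  by rewrite exprn_ege1 // ler1n.
have mul0 i : 0 <= 2 ^+ M * 2^-1 ^+ i :> R by rewrite mulr_ge0 // exprn_ge0 // ler0n.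
rewrite !mulrDr.
case: (leqP (repeats 0 s) M) => [/small le|lt0].
  by apply: le_trans le _; rewrite [leRHS]addrC -!addrA lerDl !addr_ge0.
case: (leqP (repeats 1 s) M) => [/small le|lt1].
  apply: le_trans le _; rewrite [X in _ + (X + _)]addrC [leRHS]addrC -!addrA.
  by rewrite lerDl !addr_ge0.
case: (leqP (repeats 2 s) M) => [/small le|lt2].
  by apply: le_trans le _; rewrite [X in _ + X]addrC [leRHS]addrC -!addrA lerDl !addr_ge0.
have leX : X%:R^-1 <= M%:R ^- 3 :> R.
  rewrite lef_pV2 ?posrE ?exprn_gt0 ?ltr0n // -natrX ler_nat.
  apply: leq_trans DD; rewrite !expnS expn0 muln1 mulnA.
  by rewrite !leq_mul //; lia.
by apply: le_trans leX _; rewrite lerDl !addr_ge0.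
Qed.

(** On full paths the overlap is at least [N] and [beta <= 1], so 2^(-Z) is at most beta^N times the
    potential, which starts at one. *)
Lemma path_sum_repeats_le (beta : R) (N l : nat) :
  0 < beta -> beta <= 1 ->
  (forall u : nat, (u <= k)%N -> k%:R - u%:R / 2 <= k%:R * beta ^+ u) ->
  (forall s, size s = k -> (N <= stage_overlap l s)%N) ->
  path_sum next_edge k (fun s => 2^-1 ^+ repeats l s) [::] <= (k ^ k)%:R * beta ^+ N.
Proof.
move=> b0 b1 hb hN.
apply: le_trans (_ : path_sum next_edge k (fun s => beta ^+ N * potential beta l s) [::] <= _).
  apply: path_sum_le => // s ps; rewrite addn0 => szs.
  rewrite /potential mulrCA -[leLHS]mulr1; apply: ler_wpM2l.
    by rewrite exprn_ge0 // invr_ge0 ler0n.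
  by rewrite ler_pdivlMr ?exprn_gt0 // mul1r; apply: ler_wiXn2l; rewrite ?hN // ltW.
rewrite path_sumZ mulrC ler_wpM2r ?exprn_ge0 ?(ltW b0) //.
have := @path_sum_potential beta l k [::] b0 hb isT (addn0 k).
by rewrite /potential /= !expr0 divr1 mulr1.
Qed.

Lemma card_le (beta : R) (M N : nat) : (0 < M)%N ->
  0 < beta -> beta <= 1 ->
  (forall u : nat, (u <= k)%N -> k%:R - u%:R / 2 <= k%:R * beta ^+ u) ->
  (forall l s, (l < 3)%N -> size s = k -> (N <= stage_overlap l s)%N) ->
  #|F|%:R <= (k ^ k)%:R * (M%:R ^- 3 + 2 ^+ M * (beta ^+ N *+ 3)) :> R.
Proof.
move=> M0 b0 b1 hb hN; apply: le_trans card_le_path_sum _.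
apply: le_trans (path_sum_le (h := fun s => M%:R ^- 3 + 2 ^+ M *
  (2^-1 ^+ repeats 0 s + 2^-1 ^+ repeats 1 s + 2^-1 ^+ repeats 2 s)) _ _) _ => //.
  by move=> s ps; rewrite addn0 => szs; apply: inv_step_prod_le => //; rewrite path_uniq ?szs.
rewrite path_sumD (@path_sum_const _ _ _ k) // => [|s' ps']; last first.
  by rewrite addn0 => /next_edgeP[eF _ _]; apply: uniF.
rewrite path_sumZ !path_sumD [leRHS]mulrDr lerD2l [leRHS]mulrCA ler_wpM2l ?exprn_ge0 //.
rewrite mulrnAr [leRHS]mulrSr mulr2n.
by apply: lerD; [apply: lerD|]; apply: path_sum_repeats_le => // s; apply: hN.
Qed.

End Strategy.

(** * Choice of parameters and conclusion *)

Local Open Scope ring_scope.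

Lemma card_intersecting_le : exists k0 : nat, forall k : nat, (k0 <= k)%N ->
  forall (T : finType) (F : {set {set T}}),
    kuniform k F -> intersecting F -> tau F = k -> (#|F| <= k ^ (k - 1))%N.
Proof.
have [k0 scales] := exists_scales; exists k0 => k /scales [h [M [M0 hk kh Mh [kM expM]]]].
move=> T F uniF intF tauF.
have avoidF (C : {set T}) : (#|C| < k)%N -> exists2 g, g \in F & [disjoint g & C].
  by rewrite -tauF; apply: tau_avoid.
pose R : realFieldType := rat.
have M20 : (M <= M * M)%N by rewrite leq_pmull.
have k0' : (0 < k)%N by lia.
(* With beta = 1 - 1/(2k), Bernoulli gives k beta^u >= k - u/2, the condition on [beta] in
   [card_le]. *)
pose x : R := (2 * k)%:R^-1; pose beta := 1 - x.
have x0 : 0 <= x by rewrite invr_ge0 ler0n.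
have kx : k%:R * x = 2^-1 by rewrite /x natrM invfM mulrCA mulfV ?mulr1 // pnatr_eq0 -lt0n.
have x1 : x < 1 by rewrite invf_lt1 ?ltr0n ?ltr1n; lia.
have b0 : 0 < beta by rewrite subr_gt0.
have b1 : beta <= 1 by rewrite gerBl.
have hb (u : nat) : (u <= k)%N -> k%:R - u%:R / 2 <= k%:R * beta ^+ u.
  move=> _; apply: le_trans (ler_wpM2l (ler0n _ k) (bernoulli_sub u x0 (ltW x1))).
  by rewrite mulrBr mulr1 mulrCA kx.
have ov l s : (l < 3)%N -> size s = k ->
    (2 * k * (2 * M) <= stage_overlap F (h + h) l s)%N.
  (* Here s0 = 32 M: k <= 8h gives 4kM <= h s0, and 2 s0^2 = 2048 M^2 <= h fits into the room left
     after the three stages. *)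
  move=> l3 szs; apply: leq_trans (_ : h * (32 * M) <= _)%N; first by nia.
  apply: (stage_overlap_ge intF avoidF) => //; first by lia.
    by lia.
  have : (l.+1 * (h + h) <= 6 * h)%N by nia.
  by nia.
have := card_le uniF intF avoidF M0 b0 b1 hb ov => le.
have half : beta ^+ (2 * k) <= 2^-1 by apply: exp_sub_inv_le_half; rewrite muln_gt0.
(* Since beta^(2k) <= 1/2, the left side is at most 3 * 2^M * 2^(-2M) = 3 * 2^(-M), and 6k <=
   2^M. *)
have pow : 2 ^+ M * (beta ^+ (2 * k * (2 * M)) *+ 3) <= (2 * k)%:R^-1 :> R.
  rewrite exprM mulrnAr -mulrnAl.
  apply: le_trans (_ : 2 ^+ M *+ 3 * 2^-1 ^+ (2 * M) <= _).
    apply: ler_wpM2l; first by rewrite mulrn_wge0 // exprn_ge0.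
    by apply: lerXn2r => //; rewrite nnegrE ?invr_ge0 ?ler0n // exprn_ge0 // ltW.
  rewrite mul2n -addnn exprD mulrA mulrnAl -exprMn mulfV ?pnatr_eq0 // expr1n.
  rewrite exprVn ler_pdivrMr ?exprn_gt0 ?ltr0n // mulrC ler_pdivlMr ?ltr0n ?muln_gt0 //.
  by rewrite -natrM -natrX ler_nat; lia.
have cube : M%:R ^- 3 <= (2 * k)%:R^-1 :> R.
  by rewrite lef_pV2 ?posrE ?exprn_gt0 ?ltr0n ?muln_gt0 // -natrX ler_nat.
rewrite -(ler_nat R); apply: le_trans le _.
apply: le_trans (_ : (k ^ k)%:R * k%:R^-1 <= _).
  apply: ler_wpM2l => //; apply: le_trans (lerD cube pow) _.
  by rewrite [leRHS]splitr natrM invfM mulrC.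
have -> : (k ^ k = k ^ (k - 1) * k)%N by rewrite -expnSr subn1 prednK.
by rewrite natrM mulfK // pnatr_eq0 -lt0n.
Qed.

Local Close Scope ring_scope.

From Stdlib Require Import Reals.

Theorem theorem1p3 :
  forall eps : R, (0 < eps)%R ->
  exists k0 : nat, forall k : nat, (k0 <= k)%N ->
    forall (T : finType) (F : {set {set T}}),
      kuniform k F -> intersecting F -> tau F = k ->
      (INR #|F| <= (1 + eps) * INR (k ^ (k - 1)))%R.
Proof.
move=> eps eps0; have [k0 bound] := card_intersecting_le.
exists k0 => k kk0 T F uniF intF tauF.
have le := bound k kk0 T F uniF intF tauF.
(* Powers of naturals are [Nat.pow] in this statement and [expn] in [card_intersecting_le]. *)
have powE : forall a b : nat, Nat.pow a b = expn a b.
  by move=> a; elim=> //= b ->; rewrite expnS multE.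
rewrite powE; apply: Rle_trans (le_INR _ _ (elimT ssrnat.leP le)) _.
rewrite -{1}[INR (expn _ _)]Rmult_1_l; apply: Rmult_le_compat_r.
  exact: pos_INR.
rewrite -{1}[IZR 1]Rplus_0_r; apply: Rplus_le_compat_l; exact: Rlt_le.
Qed.
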